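(* Let $n$ be any positive integer, let $B$ be a fork with $n$ vertices, and let $\boldsymbol{w}$ be a fork-preserving mutation sequence from $B$. Then $$\mathbf{r}_{\lambda(1)}^{\boldsymbol{w}}\cdots\mathbf{r}_{\lambda(n)}^{\boldsymbol{w}}=\mathbf{r}_{\rho(1)}\cdots\mathbf{r}_{\rho(n)}$$ for some permutations $\lambda,\rho\in\mathfrak S_n$, where $\mathfrak S_n$ is the symmetric group on $\{1,\dots,n\}$ and $\mathbf{r}_1,\dots,\mathbf{r}_n$ are the initial reflections. Moreover, when $\boldsymbol{w}$ is non-empty, one can take $\lambda(i)$ to be the $i$-th element of the sign-adapted ordering of the fork $B^{\boldsymbol{w}}$ (defined in the context), and $\rho$ to be determined (given $B$) by the first mutation of $\boldsymbol{w}$.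
   Context: A quiver on the vertex set $\{1,\dots,n\}$ (no loops, no oriented 2-cycles) is identified with an $n\times n$ skew-symmetric integer matrix $B=[b_{ij}]$: if $b_{ij}>0$ there are $b_{ij}$ arrows from $i$ to $j$. Mutation: for an $n\times 2n$ integer matrix $M=[m_{ij}]$ and $k\in\{1,\dots,n\}$, the mutation of $M$ at $k$ is the matrix with entries $-m_{ij}$ if $i=k$ or $j=k$, and $m_{ij}+\mathrm{sgn}(m_{ik})\max(m_{ik}m_{kj},0)$ otherwise. A mutation sequence $\boldsymbol{w}=[i_1,\dots,i_\ell]$ (possibly empty) means mutating at $i_1$, then $i_2$, etc.; $\boldsymbol{w}[k]$ is $\boldsymbol{w}$ followed by $k$; $\boldsymbol{w}$ is reduced if $i_j\ne i_{j+1}$ for all $j$. Starting from $[B\mid I]$, the result after $\boldsymbol{w}$ is written $[B^{\boldsymbol{w}}\mid C^{\boldsymbol{w}}]$ with $B^{\boldsymbol{w}}=[b_{ij}^{\boldsymbol{w}}]$; the rows $c_i^{\boldsymbol{w}}$ of $C^{\boldsymbol{w}}$ are the $c$-vectors (known to be nonzero, with all nonzero entries of one sign). For a nonzero vector $c$, $c>0$ (positive) means all entries are $\ge0$ and $c<0$ (negative) means all entries are $\le 0$. Reflections: $\mathcal W=\langle s_1,\dots,s_n\mid s_i^2=1\rangle$ is the universal Coxeter group. Set $\mathbf{r}_i=\mathbf{r}_i^{[\,]}=s_i$ and inductively $\mathbf{r}_i^{\boldsymbol{w}[k]}=\mathbf{r}_k^{\boldsymbol{w}}\mathbf{r}_i^{\boldsymbol{w}}\mathbf{r}_k^{\boldsymbol{w}}$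 if $b_{ik}^{\boldsymbol{w}}c_k^{\boldsymbol{w}}>0$, and $\mathbf{r}_i^{\boldsymbol{w}[k]}=\mathbf{r}_i^{\boldsymbol{w}}$ otherwise. A quiver is abundant if there are at least two arrows between every pair of distinct vertices. A fork is an abundant, non-acyclic quiver $F=[f_{ij}]$ with a vertex $r$ (the point of return, which is unique) such that, with $F^-(r)$ the set of vertices having arrows to $r$ and $F^+(r)$ the set of vertices receiving arrows from $r$: for all $i\in F^-(r)$, $j\in F^+(r)$ one has $f_{ji}>f_{ir}$ and $f_{ji}>f_{rj}$; and the full subquivers on $F^-(r)$ and on $F^+(r)$ are acyclic. Then $F\setminus\{r\}$ is acyclic. A fork-preserving mutation sequence from a fork with point of return $r$ is a reduced mutation sequence whose first mutation (if any) is not at $r$. It is known that if $\boldsymbol{w}$ is a non-empty fork-preserving sequence from $B$ ending in $r$, then $B^{\boldsymbol{w}}$ is a fork with point of return $r$. Sign-adapted ordering: for such non-empty $\boldsymbol{w}$ ending in $r$, let $v_1,\dots,v_{n-1}$ be the vertices of $B^{\boldsymbol{w}}\setminus\{r\}$ listed so that every arrow $v_s\to v_t$ has $s<t$. There is a unique $j\in\{0,\dots,n-1\}$ such that $c^{\boldsymbol{w}}_{v_s}>0$ for $s\le j$ and $c^{\boldsymbol{w}}_{v_s}<0$ for $s>j$; the sign-adapted ordering is $$v_j\prec v_{j-1}\prec\dots\prec v_1\prec r\prec v_{n-1}\prec v_{n-2}\prec\dots\prec v_{j+1},$$ which is a cyclic permutation of $r\prec v_{n-1}\prec\dots\prec v_1$.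 *)

(* Defs.v *)
From HB Require Import structures.
From mathcomp Require Import all_boot all_order all_algebra all_fingroup.

Set Implicit Arguments.
Unset Strict Implicit.
Unset Printing Implicit Defensive.

Import Order.TTheory GRing.Theory Num.Theory.

Local Open Scope ring_scope.

Section Quivers.
Variable n : nat.
Implicit Types (B : 'M[int]_n) (S : {set 'I_n}) (r : 'I_n).

Definition quiver B : Prop := B^T = - B.

Definition arrow B : rel 'I_n := [rel i j | 0 < B i j].

Definition abundant B : Prop := forall i j, i != j -> 2 <= `|B i j|.

(* The full subquiver of B on the vertex set S has no oriented cycle; c is the
   list of successive vertices of a closed walk. *)
Definition acyclic_on B S : Prop :=
  forall c : seq 'I_n,
    c != [::] -> {subset c <= S} -> ~~ path.cycle (arrow B) c.

Definition acyclic B : Prop := acyclic_on B [set: 'I_n].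

Definition in_nbrs B r : {set 'I_n} := [set i | arrow B i r].
Definition out_nbrs B r : {set 'I_n} := [set j | arrow B r j].

Record fork B r : Prop := Fork {
  fork_quiver : quiver B;
  fork_abundant : abundant B;
  fork_nonacyclic : ~ acyclic B;
  fork_return : forall i j, i \in in_nbrs B r -> j \in out_nbrs B r ->
                  B i r < B j i /\ B r j < B j i;
  fork_in_acyclic : acyclic_on B (in_nbrs B r);
  fork_out_acyclic : acyclic_on B (out_nbrs B r)
}.

End Quivers.

Section Mutation.
Variable n : nat.
Implicit Types (B : 'M[int]_n) (M : 'M[int]_(n, n + n)) (w : seq 'I_n).

Definition mutation M (k : 'I_n) : 'M[int]_(n, n + n) :=
  \matrix_(i, j)
    if (i == k) || (j == lshift n k) then - M i j
    else M i j
         + Num.sg (M i (lshift n k)) * Num.max (M i (lshift n k) * M k j) 0.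

Definition framed_mut B w : 'M[int]_(n, n + n) :=
  foldl mutation (row_mx B 1%:M) w.

Definition Bmx B w : 'M[int]_n := lsubmx (framed_mut B w).
Definition Cmx B w : 'M[int]_n := rsubmx (framed_mut B w).
Definition cvec B w (i : 'I_n) : 'rV[int]_n := row i (Cmx B w).

Definition posvec (c : 'rV[int]_n) : bool := (c != 0) && [forall j, 0 <= c 0 j].
Definition negvec (c : 'rV[int]_n) : bool := (c != 0) && [forall j, c 0 j <= 0].

Definition reduced w : bool := sorted [rel i j | i != j] w.

Definition fork_preserving (r : 'I_n) w : bool :=
  reduced w && (if w is k :: _ then k != r else true).

End Mutation.

(* The group < s_1, ..., s_n | s_i^2 = 1 >, realized on the words in the letters
   s_i without two equal consecutive letters.  The product is concatenation
   followed by cancellation of adjacent equal letters; [ucox_presentation] below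
   states that this is the group given by the presentation. *)
Section UniversalCoxeter.
Variable n : nat.
Implicit Types (i : 'I_n) (u v : seq 'I_n).

Record ucox : Type := UCox { ucox_word :> seq 'I_n; _ : reduced ucox_word }.

HB.instance Definition _ := [isSub for ucox_word].
HB.instance Definition _ := [Choice of ucox by <:].

Definition letter_mul i v : seq 'I_n :=
  if v is j :: v' then if i == j then v' else i :: v else [:: i].

Definition word_mul u v : seq 'I_n := foldr letter_mul v u.

Lemma reduced_letter_mul i v : reduced v -> reduced (letter_mul i v).
Proof.
case: v => [|j v] //= rv; case: eqP => [_|/eqP nij] /=; last by rewrite nij.
exact: path_sorted rv.
Qed.

Lemma reduced_word_mul u v : reduced v -> reduced (word_mul u v).
Proof. by move=> rv; elim: u => //= i u; apply: reduced_letter_mul. Qed.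

Lemma reduced_rev u : reduced u -> reduced (rev u).
Proof.
by rewrite /reduced rev_sorted; apply: sub_sorted => i j /=; rewrite eq_sym.
Qed.

Lemma letter_mulK i v : reduced v -> letter_mul i (letter_mul i v) = v.
Proof.
case: v => [|j v] /=; first by rewrite eqxx.
case: (i =P j) => [<-|_ _] /=; last by rewrite eqxx.
by case: v => [|k v] //= /andP[/negPf->].
Qed.

Lemma word_mul_letter i v x :
  reduced x -> word_mul (letter_mul i v) x = letter_mul i (word_mul v x).
Proof.
move=> rx; case: v => [|j v] //=; case: eqP => [<-|_] //=.
by rewrite letter_mulK //; apply: reduced_word_mul.
Qed.

Lemma word_mulA u v x :
  reduced x -> word_mul u (word_mul v x) = word_mul (word_mul u v) x.
Proof. by move=> rx; elim: u => //= i u ->; rewrite word_mul_letter. Qed.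

Lemma word_mul0 u : reduced u -> word_mul u [::] = u.
Proof.
elim: u => //= i u IHu ru; rewrite IHu; last exact: path_sorted ru.
by case: u ru {IHu} => [|j u] //= /andP[/negPf->].
Qed.

Lemma word_mulV u x : reduced x -> word_mul u (word_mul (rev u) x) = x.
Proof.
elim: u x => //= i u IHu x rx; rewrite rev_cons -cats1 /word_mul foldr_cat /=.
by rewrite [foldr _ _ _]IHu ?letter_mulK //; apply: reduced_letter_mul.
Qed.

Definition ucox_one : ucox := @UCox [::] isT.
Definition ucox_mul (x y : ucox) : ucox :=
  UCox (reduced_word_mul x (valP y)).
Definition ucox_inv (x : ucox) : ucox := UCox (reduced_rev (valP x)).

Fact ucox_mulA : associative ucox_mul.
Proof. by move=> x y z; apply/val_inj/word_mulA/(valP z). Qed.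

Fact ucox_mul1 : left_id ucox_one ucox_mul.
Proof. by move=> x; apply/val_inj. Qed.

Fact ucox_mulr1 : right_id ucox_one ucox_mul.
Proof. by move=> x; apply/val_inj/word_mul0/(valP x). Qed.

Fact ucox_mulrV : right_inverse ucox_one ucox_inv ucox_mul.
Proof.
move=> x; apply/val_inj => /=.
by rewrite -[rev x]word_mul0 ?word_mulV //; apply/reduced_rev/(valP x).
Qed.

Fact ucox_mulV : left_inverse ucox_one ucox_inv ucox_mul.
Proof.
move=> x; have {2}-> : x = ucox_inv (ucox_inv x).
  by apply/val_inj; rewrite /= revK.
exact: ucox_mulrV.
Qed.

HB.instance Definition _ :=
  isGroup.Build ucox ucox_mulA ucox_mul1 ucox_mulr1 ucox_mulV ucox_mulrV.

Definition ucox_gen i : ucox := @UCox [:: i] isT.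

Local Open Scope group_scope.

Lemma ucox_gen2 i : ucox_gen i * ucox_gen i = 1.
Proof. by apply/val_inj; rewrite /= eqxx. Qed.

Lemma ucox_genE (x : ucox) : x = \prod_(i <- ucox_word x) ucox_gen i.
Proof.
suff H u : reduced u -> val (\prod_(i <- u) ucox_gen i) = u.
  by apply/val_inj; rewrite [RHS]H //; apply: (valP x).
elim: u => [|i u IHu] ru; first by rewrite big_nil.
rewrite big_cons /= IHu; last exact: path_sorted ru.
by case: u ru {IHu} => [|j u] //= /andP[/negPf->].
Qed.

Lemma ucox_presentation (G : groupType) (f : 'I_n -> G) :
    (forall i, f i * f i = 1) ->
  exists2 phi : ucox -> G,
    {morph phi : x y / x * y} /\ (forall i, phi (ucox_gen i) = f i)
  & forall psi : ucox -> G,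
      {morph psi : x y / x * y} -> (forall i, psi (ucox_gen i) = f i) ->
      psi =1 phi.
Proof.
move=> f2; pose F (u : seq 'I_n) := \prod_(i <- u) f i.
have Fl i u : F (letter_mul i u) = f i * F u.
  rewrite /F; case: u => [|j u] /=; first by rewrite big_seq1 big_nil mulg1.
  by case: eqP => [->|_]; rewrite !big_cons // mulgA f2 mul1g.
exists (fun x : ucox => F x); first split.
- move=> x y /=; rewrite /= {2}/F; elim: (ucox_word x) => [|i u IHu] /=.
    by rewrite big_nil mul1g.
  by rewrite Fl IHu big_cons mulgA.
- by move=> i; rewrite /F /= big_seq1.
move=> psi psiM psif x.
have psi1 : psi 1 = 1 by apply: (mulgI (psi 1)); rewrite -psiM !mulg1.
rewrite [x in LHS]ucox_genE (big_morph psi psiM psi1).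
by apply: eq_bigr => i _; rewrite psif.
Qed.

End UniversalCoxeter.

Section Reflections.
Variable n : nat.
Implicit Types (B : 'M[int]_n) (w : seq 'I_n).

Local Open Scope group_scope.

Definition refl_step (M : 'M[int]_(n, n + n)) (k : 'I_n)
    (R : 'I_n -> ucox n) (i : 'I_n) : ucox n :=
  if posvec (lsubmx M i k *: row k (rsubmx M))%R then R k * R i * R k else R i.

Definition reflection B w : 'I_n -> ucox n :=
  (foldl (fun MR k => (mutation MR.1 k, refl_step MR.1 k MR.2))
         (row_mx B 1%:M, @ucox_gen n) w).2.

Lemma reflection_nil B : reflection B [::] = @ucox_gen n.
Proof. by []. Qed.

Lemma reflection_rcons B w k i :
  reflection B (rcons w k) i =
  if posvec (Bmx B w i k *: cvec B w k)%R
  then reflection B w k * reflection B w i * reflection B w k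
  else reflection B w i.
Proof.
rewrite /reflection /Bmx /cvec /Cmx /framed_mut -cats1 foldl_cat /=.
suff -> M R : (foldl (fun MR k0 => (mutation MR.1 k0, refl_step MR.1 k0 MR.2))
  (M, R) w).1 = foldl (@mutation n) M w by [].
by elim: w M R => //= l w IHw M R; apply: IHw.
Qed.

End Reflections.

(* lam lists the sign-adapted ordering of B^w, where w ends in r, from the
   smallest to the largest vertex.  The list v is v_1, ..., v_(n-1), so that
   [take j v] is v_1, ..., v_j and [drop j v] is v_(j+1), ..., v_(n-1). *)
Definition sign_adapted n (B : 'M[int]_n) (w : seq 'I_n) (r : 'I_n)
    (lam : 'S_n) : Prop :=
  exists (v : seq 'I_n) (j : nat),
    [/\ perm_eq v (enum [set~ r]),
        forall s t, (s < size v)%N -> (t < size v)%N ->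
          arrow (Bmx B w) (nth r v s) (nth r v t) -> (s < t)%N,
        [/\ (j <= size v)%N, all (fun i => posvec (cvec B w i)) (take j v)
          & all (fun i => negvec (cvec B w i)) (drop j v)]
      & codom lam = rev (take j v) ++ r :: rev (drop j v)].

(* Main.v *)
Require Import Defs.
From mathcomp Require Import all_boot all_order all_algebra all_fingroup.
From mathcomp Require Import zify.

(* The sign-adapted ordering P ++ r :: N of the fork B^w, read as a product of
   reflections, does not change under mutation.  When c_k > 0, mutating at k
   conjugates by r_k exactly the reflections of the vertices with arrows to k;
   these stand immediately after k in the ordering, and since
   (r_k x r_k) r_k = r_k x the new product, in which k is moved past them,
   equals the old one.  The case c_k < 0 follows by the symmetry M -> -M, which
   reverses the ordering and hence inverts the product of involutions.
   Sign coherence is part of the induction: besides the signs one carries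
   c_v <= -c_r for the v with arrows to r when c_r > 0, and c_v >= -c_r for the
   v receiving arrows from r when c_r < 0.  The framed quiver satisfies the fork
   conditions but not this inequality, so the first mutation is treated apart:
   depending on the direction of the arrow between r and k, one starts from r
   put last or first. *)

Set Implicit Arguments.
Unset Strict Implicit.
Unset Printing Implicit Defensive.

Import Order.TTheory GRing.Theory Num.Theory.

Local Open Scope ring_scope.

Lemma pairwise_rev (T : Type) (e : rel T) s :
  pairwise e (rev s) = pairwise (fun x y => e y x) s.
Proof.
elim: s => //= x s IHs.
by rewrite rev_cons pairwise_rcons all_rev IHs.
Qed.

Lemma mulr_ge2 (x y : int) :
  2 <= x -> 2 <= y -> 2 * x <= x * y /\ 2 * y <= x * y.
Proof.
by move=> x2 y2; split; [rewrite mulrC ler_pM2l|rewrite ler_pM2r]; lia.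
Qed.

(** * Entrywise mutation rules for the two blocks of the matrix *)

Section MutationRules.
Variable n : nat.
Implicit Types (M : 'M[int]_(n, n + n)) (i j k r : 'I_n).

Lemma mutationN M k : mutation (- M) k = - mutation M k.
Proof.
apply/matrixP => i j; rewrite !mxE; case: ifP => // _.
by rewrite mulrNN sgrN mulNr opprD.
Qed.

Lemma lsub_mutation M k i j : lsubmx (mutation M k) i j =
  if (i == k) || (j == k) then - lsubmx M i j
  else lsubmx M i j
       + Num.sg (lsubmx M i k) * Num.max (lsubmx M i k * lsubmx M k j) 0.
Proof. by rewrite !mxE (inj_eq (@lshift_inj n n)). Qed.

Lemma rsub_mutation M k i j : rsubmx (mutation M k) i j =
  if i == k then - rsubmx M i j
  else rsubmx M i j
       + Num.sg (lsubmx M i k) * Num.max (lsubmx M i k * rsubmx M k j) 0.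
Proof. by rewrite !mxE eq_rlshift orbF. Qed.

Lemma lsub_mutation_l M k j : lsubmx (mutation M k) k j = - lsubmx M k j.
Proof. by rewrite lsub_mutation eqxx. Qed.

Lemma lsub_mutation_r M k i : lsubmx (mutation M k) i k = - lsubmx M i k.
Proof. by rewrite lsub_mutation eqxx orbT. Qed.

Lemma lsub_mutation_path M k i j : i != k -> j != k ->
    0 <= lsubmx M i k -> 0 <= lsubmx M k j ->
  lsubmx (mutation M k) i j = lsubmx M i j + lsubmx M i k * lsubmx M k j.
Proof.
move=> /negPf ik /negPf jk bi bj.
rewrite lsub_mutation ik jk /= max_l ?mulr_ge0 //.
have [->|b0] := eqVneq (lsubmx M i k) 0; first by rewrite sgr0 !mul0r.
by rewrite gtr0_sg ?mul1r // lt_def b0.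
Qed.

Lemma lsub_mutation_nopath M k i j : i != k -> j != k ->
  lsubmx M i k * lsubmx M k j <= 0 ->
  lsubmx (mutation M k) i j = lsubmx M i j.
Proof.
move=> /negPf ik /negPf jk bij; rewrite lsub_mutation ik jk /=.
by rewrite max_r // mulr0 addr0.
Qed.

End MutationRules.

(** * Forks as linear orders, and how mutation moves the point of return *)

Section ForkOrder.
Variable n : nat.
Implicit Types (M : 'M[int]_(n, n + n)) (b : 'M[int]_n) (i j k r : 'I_n).
Implicit Types (L X Y : seq 'I_n).

(* L lists the vertices other than r against the arrows. *)
Record fork_order b r L : Prop := ForkOrder {
  fo_perm : perm_eq (r :: L) (enum 'I_n);
  fo_skew : forall i j, b i j = - b j i;
  fo_pairwise : pairwise (fun i j => 2 <= b j i) L;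
  fo_abundant : forall i, i != r -> 2 <= `|b i r|;
  fo_return : forall i j, 0 < b i r -> 0 < b r j ->
                b i r < b j i /\ b r j < b j i
}.

(** Reversing all arrows exchanges the in- and out-neighbours of [r], and the return condition is
    symmetric under this exchange. *)
Lemma fork_orderN b r L : fork_order b r L -> fork_order (- b) r (rev L).
Proof.
case=> bP bS bL bA bR; split=> [|i j||i ir|i j]; rewrite ?mxE.
- by apply: perm_trans bP; rewrite perm_cons perm_rev.
- by rewrite bS.
- rewrite pairwise_rev; apply: sub_pairwise bL => i j /=.
  by rewrite mxE -bS.
- by rewrite normrN bA.
- rewrite -!bS => ri jr; have [] := bR _ _ jr ri; have := bS i j; lia.
Qed.

Lemma fork_order_mem b r L i : fork_order b r L -> (i \in L) = (i != r).
Proof.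
case=> bP _ _ _ _; have := perm_mem bP i; rewrite mem_enum !inE.
have := perm_uniq bP; rewrite enum_uniq /= => /andP[rL _].
by case: eqP => [->|] //=; rewrite (negPf rL).
Qed.

Lemma fork_order_uniq b r L : fork_order b r L -> uniq L.
Proof.
by case=> bP _ _ _ _; have := perm_uniq bP; rewrite enum_uniq => /andP[].
Qed.

Lemma fork_order_split b r X k Y : fork_order b r (X ++ k :: Y) ->
  [/\ forall i, i \in X -> [/\ i != k, i != r & 2 <= b k i],
      forall i, i \in Y -> [/\ i != k, i != r & 2 <= b i k] & k != r].
Proof.
move=> fo; have mem := fork_order_mem _ fo; have := fork_order_uniq fo.
have := fo_pairwise fo.
rewrite pairwise_cat cat_uniq /= allrel_consr negb_or.
case/and3P=> /andP[/allP Xk _] _ /andP[/allP kY _].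
case/and3P=> _ /andP[kX _] /andP[kY' _].
split=> [i iX|i iY|].
- by rewrite -mem mem_cat iX; split=> //;
    [apply: contraNneq kX => <-|exact: Xk].
- by rewrite -mem mem_cat inE iY !orbT; split=> //;
    [apply: contraNneq kY' => <-|exact: kY].
- by rewrite -mem mem_cat inE eqxx orbT.
Qed.

(** The paths through [k] from [i] to [j] and back have the same product, and when it is positive
    its two factors have the same sign; so the two corrections are opposite. *)
Lemma lsub_mutation_skew M k :
  (forall i j, lsubmx M i j = - lsubmx M j i) ->
  forall i j, lsubmx (mutation M k) i j = - lsubmx (mutation M k) j i.
Proof.
move=> bS i j; rewrite !lsub_mutation orbC; case: ifP => _; first by rewrite bS.
rewrite opprD -bS; congr (_ + _).
rewrite (bS j k) (bS k i) sgrN mulrNN mulNr opprK.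
rewrite (mulrC (lsubmx M k j)).
have [p|p] := ltP 0 (lsubmx M i k * lsubmx M k j); last by rewrite !mulr0.
congr (_ * _); have [x|x|x] := ltgtP (lsubmx M i k) 0.
- by rewrite !ltr0_sg //; move: p; rewrite nmulr_rgt0.
- by rewrite !gtr0_sg //; move: p; rewrite pmulr_rgt0.
- by move: p; rewrite x mul0r ltxx.
Qed.

(** After the mutation [r] has arrows to all of [X] and [Y], hence its last place. Among the other
    vertices only the arrows from [Y] to [X] change: the paths through [k] reinforce them, until
    they outnumber those at [k], the new point of return. *)
Lemma fork_order_mutation_out M r X k Y :
    fork_order (lsubmx M) r (X ++ k :: Y) -> 0 < lsubmx M r k ->
  fork_order (lsubmx (mutation M k)) k (X ++ Y ++ [:: r]).
Proof.
move=> fo rk; have [Xk Yk kr] := fork_order_split fo.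
have mem := fork_order_mem _ fo.
case: (fo) => bP bS bL bA bR.
have rk2 : 2 <= lsubmx M r k by have := bA k kr; have := bS k r; lia.
have memXY i : i != r -> i != k -> i \in X \/ i \in Y.
  by move=> ir ik; apply/orP; move: (mem i); rewrite mem_cat inE ir (negPf ik).
(* If [i] has arrows to [r], the return condition for [i], [r], [k] bounds their number by
   [lsubmx M k i]; a product of two factors at least 2 outweighs this loss. *)
have rX i : i \in X -> lsubmx M k i < lsubmx (mutation M k) r i
                    /\ lsubmx M r k < lsubmx (mutation M k) r i.
  move=> iX; have [ik ir ki] := Xk i iX.
  rewrite eq_sym in kr.
  rewrite (lsub_mutation_path kr ik (ltW rk) (le_trans _ ki)) //.
  have := mulr_ge2 rk2 ki; have := bA i ir; have := bR i k; have := bS i r; lia.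
(* An arrow from [i] to [r] would force arrows from [k] to [i] by the return condition, against [i]
   being in [Y]; so the arrows already leave [r]. *)
have rY i : i \in Y -> 2 <= lsubmx (mutation M k) r i.
  move=> iY; have [ik ir ki] := Yk i iY; have kiS := bS k i.
  have rki : lsubmx M r k * lsubmx M k i <= 0 by apply: mulr_ge0_le0; lia.
  rewrite eq_sym in kr; rewrite (lsub_mutation_nopath kr ik rki).
  have := bA i ir; have := bR i k; have := bS i r; lia.
have YX i j : i \in X -> j \in Y -> lsubmx (mutation M k) j i =
    lsubmx M j i + lsubmx M j k * lsubmx M k i.
  move=> /Xk[ik _ ki] /Yk[jk _ kj]; apply: lsub_mutation_path => //; lia.
have := bL; rewrite pairwise_cat allrel_consr /=.
case/and3P=> /andP[_ /allrelP XY] bX /andP[_ bY].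
split.
- by apply: perm_trans bP; apply/seq.permP => a; rewrite /= !count_cat /=; lia.
- exact: lsub_mutation_skew.
- rewrite catA pairwise_cat [pairwise _ [:: r]]/= andbT; apply/andP; split.
  + rewrite allrel1r all_cat; apply/andP; split; apply/allP => i iX.
      by have [_ _ ki] := Xk i iX; apply/(le_trans ki)/ltW/(rX i iX).1.
    exact: rY.
  + rewrite pairwise_cat; apply/and3P; split.
    * apply/allrelP => i j iX jY; rewrite (YX i j iX jY).
      have [_ _ ki] := Xk i iX; have [_ _ kj] := Yk j jY.
      by rewrite ler_wpDr ?XY // mulr_ge0 // (le_trans _ ki, le_trans _ kj).
    * apply: (sub_in_pairwise _ (allss X) bX) => i j iX jX /= ij.
      have [ik _ ki] := Xk i iX; have [jk _ kj] := Xk j jX.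
      rewrite (lsub_mutation_nopath jk ik) // (bS j) mulNr oppr_le0 mulr_ge0 //.
        exact: le_trans kj.
      exact: le_trans ki.
    * apply: (sub_in_pairwise _ (allss Y) bY) => i j iY jY /= ij.
      have [ik _ ki] := Yk i iY; have [jk _ kj] := Yk j jY.
      rewrite (lsub_mutation_nopath jk ik) // (bS k) mulrN oppr_le0 mulr_ge0 //.
        exact: le_trans kj.
      exact: le_trans ki.
- move=> i ik; rewrite lsub_mutation_r normrN.
  have [->|ir] := eqVneq i r; first by rewrite ger0_norm ?(ltW rk).
  case: (memXY i ir ik) => [/Xk|/Yk] [_ _ ki]; last first.
    by rewrite ger0_norm ?(le_trans _ ki).
  by rewrite bS normrN ger0_norm ?(le_trans _ ki).
(* The arrows at [k] are now reversed: its in-neighbours form [X], its out-neighbours are [r] and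
   [Y]. *)
- move=> i j; rewrite lsub_mutation_r lsub_mutation_l -!bS => ki kj.
  have kk : lsubmx M k k = 0 by have := bS k k; lia.
  have no2 x y : 2 <= lsubmx M x y -> (0 < lsubmx M y x) = false.
    by rewrite (bS y x) oppr_gt0 => xy; apply/lt_gtF/(lt_le_trans _ xy).
  have ik : i != k by apply: contraTneq ki => ->; rewrite kk ltxx.
  have jk : j != k by apply: contraTneq kj => ->; rewrite kk ltxx.
  have ir : i != r by apply: contraTneq ki => ->; rewrite (bS k); lia.
  have iX : i \in X.
    by case: (memXY i ir ik) => [//|/Yk[_ _ /no2]]; rewrite ki.
  have [jr|jr] := eqVneq j r; first by rewrite jr; apply: rX.
  have jY : j \in Y.
    by case: (memXY j jr jk) => [/Xk[_ _ /no2]|//]; rewrite kj.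
  have [_ _ ki2] := Xk i iX; have [_ _ kj2] := Yk j jY; have := XY i j iX jY.
  by rewrite (YX i j iX jY); have [] := mulr_ge2 kj2 ki2; clear -kj2 ki2; lia.
Qed.

Lemma fork_order_mutation_in M r X k Y :
    fork_order (lsubmx M) r (X ++ k :: Y) -> 0 < lsubmx M k r ->
  fork_order (lsubmx (mutation M k)) k (r :: X ++ Y).
Proof.
move=> fo kr; have lsubN M' : lsubmx (- M') = - lsubmx M'.
  by apply/matrixP=> i j; rewrite !mxE.
have := fork_orderN fo; rewrite -lsubN rev_cat rev_cons cat_rcons.
move/fork_order_mutation_out; rewrite lsubN mxE -(fo_skew fo).
move/(_ kr)/fork_orderN.
by rewrite mutationN lsubN opprK !rev_cat !revK.
Qed.

End ForkOrder.

(** * Positive and negative vectors *)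

Section SignedVectors.
Variable n : nat.
Implicit Types (u v : 'rV[int]_n) (a : int).

Lemma posvec_le u v : posvec u -> (forall j, u 0 j <= v 0 j) -> posvec v.
Proof.
case/andP=> u0 /forallP u_ge0 uv; apply/andP; split; last first.
  by apply/forallP => j; apply: le_trans (uv j).
apply: contraNneq u0 => v0; apply/eqP/rowP => j; apply/le_anti.
by rewrite mxE u_ge0 andbT; have := uv j; rewrite v0 mxE.
Qed.

Lemma posvecN u : posvec (- u) = negvec u.
Proof.
rewrite /posvec /negvec oppr_eq0; congr (_ && _).
by apply: eq_forallb => j; rewrite mxE oppr_ge0.
Qed.

Lemma negvecN u : negvec (- u) = posvec u.
Proof. by rewrite -posvecN opprK. Qed.

Lemma posvec_negvecF u : posvec u -> negvec u = false.
Proof.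
case/andP=> u0 /forallP u_ge0; apply: contraNF u0 => /andP[_ /forallP u_le0].
by apply/eqP/rowP => j; apply/le_anti; rewrite mxE u_ge0 u_le0.
Qed.

(** Reduces the test in the reflection rule to the sign of the matrix entry once [c_k] is
    positive. *)
Lemma posvec_scale a u : posvec u -> posvec (a *: u) = (0 < a).
Proof.
move=> /[dup] up /andP[u0 /forallP u_ge0].
have [a0|a0|<-] := ltgtP 0 a; last by rewrite scale0r /posvec eqxx.
- apply/andP; split; last by apply/forallP => j; rewrite mxE mulr_ge0 // ltW.
  apply: contraNneq u0 => /rowP au0; apply/eqP/rowP => j; apply/eqP.
  by move/eqP: (au0 j); rewrite !mxE mulf_eq0 (gt_eqF a0).
- apply: contraTF up => /andP[_ /forallP au_ge0]; apply: contra u0 => _.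
  apply/eqP/rowP => j; apply/le_anti; rewrite mxE u_ge0 andbT.
  by have := au_ge0 j; rewrite mxE nmulr_rge0.
Qed.

End SignedVectors.

(** * Signs of the c-vectors along a fork order *)

Section ForkState.
Variable n : nat.
Implicit Types (M : 'M[int]_(n, n + n)) (i j k r : 'I_n).
Implicit Types (P N X Y Z : seq 'I_n) (R : 'I_n -> ucox n).

Local Notation c M i := (row i (rsubmx M)).
Local Notation b M i j := (lsubmx M i j).

Lemma row_mutation_self M k : c (mutation M k) k = - c M k.
Proof. by apply/rowP => j; rewrite [LHS]mxE rsub_mutation eqxx !mxE. Qed.

Lemma row_mutation_pos M k i j : posvec (c M k) -> i != k ->
  c (mutation M k) i 0 j = c M i 0 j + Num.max (b M i k) 0 * c M k 0 j.
Proof.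
move=> /andP[_ /forallP/(_ j)] + /negPf ik.
rewrite ![row _ _ _ _]mxE rsub_mutation ik => ck; congr (_ + _).
have [bik|bik] := leP (b M i k) 0.
  by rewrite max_r ?mulr0 ?mul0r // mulr_le0_ge0.
by rewrite gtr0_sg // mul1r max_l // mulr_ge0 // ltW.
Qed.

(* [rev (N ++ P)] is v_1, ..., v_(n-1) and [P ++ r :: N] is the sign-adapted
   ordering. *)
Record signed_order M r P N : Prop := SignedOrder {
  so_order : fork_order (lsubmx M) r (N ++ P);
  so_pos : forall i, i \in P -> posvec (c M i);
  so_neg : forall i, i \in N -> negvec (c M i);
  so_return :
    (posvec (c M r) /\
       forall i, 0 < b M i r -> forall j, c M r 0 j <= - c M i 0 j) \/
    (negvec (c M r) /\
       forall i, 0 < b M r i -> forall j, - c M r 0 j <= c M i 0 j)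
}.

(** Negation flips arrows and signs at once: [P] and [N] trade places, both lists are reversed, and
    the two alternatives of [so_return] are exchanged. *)
Lemma signed_orderN M r P N :
  signed_order M r P N -> signed_order (- M) r (rev N) (rev P).
Proof.
have lN : lsubmx (- M) = - lsubmx M by apply/matrixP => i j; rewrite !mxE.
have cN i : c (- M) i = - c M i by apply/rowP => j; rewrite !mxE.
case=> foM pos neg ret; split.
- by rewrite lN -rev_cat; apply: fork_orderN.
- by move=> i; rewrite mem_rev cN posvecN; apply: neg.
- by move=> i; rewrite mem_rev cN negvecN; apply: pos.
- rewrite cN posvecN negvecN lN.
  case: ret => [[rp ret]|[rn ret]]; [right|left]; split=> // i; rewrite mxE.
    rewrite -(fo_skew foM) cN => /ret le_ri j.
    by rewrite [(- c M r) _ _]mxE [(- c M i) _ _]mxE opprK.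
  rewrite -(fo_skew foM) cN => /ret le_ri j.
  by rewrite [(- c M r) _ _]mxE [(- c M i) _ _]mxE opprK.
Qed.

Lemma row_mutation_fixed M k i :
  posvec (c M k) -> i != k -> b M i k <= 0 -> c (mutation M k) i = c M i.
Proof.
move=> ck ik bik; apply/rowP => j.
by rewrite row_mutation_pos // max_r // mul0r addr0.
Qed.

(** The new row is [c_i + b_ik c_k] with [c_i] non-negative and [b_ik] at least 2. This bound
    becomes the negative alternative of [so_return] when [k] is the point of return. *)
Lemma row_mutation_ge M k i j :
    posvec (c M k) -> posvec (c M i) -> i != k -> 2 <= b M i k ->
  c M k 0 j <= c (mutation M k) i 0 j.
Proof.
move=> ck /andP[_ /forallP ci] ik bik; rewrite row_mutation_pos //.
case/andP: ck => _ /forallP ck.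
rewrite max_l ?(le_trans _ bik) // ler_wpDl // ler_peMl //.
exact: le_trans bik.
Qed.

(** * Mutation at a vertex [k] with positive c-vector, the positive vertices being split at [k] *)

Section PositiveMutation.
Variables (M : 'M[int]_(n, n + n)) (k r : 'I_n) (N X Y : seq 'I_n).
Hypothesis fo : fork_order (lsubmx M) r (N ++ X ++ k :: Y).
Hypothesis pos : forall i, i \in X ++ k :: Y -> posvec (c M i).
Hypothesis neg : forall i, i \in N -> negvec (c M i).

Let bS i j : b M i j = - b M j i. Proof. exact: fo_skew fo i j. Qed.

Let split_order :
  [/\ forall i, i \in N ++ X -> [/\ i != k, i != r & 2 <= b M k i],
      forall i, i \in Y -> [/\ i != k, i != r & 2 <= b M i k] & k != r].
Proof. by apply: fork_order_split; rewrite -catA. Qed.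

Let ck : posvec (c M k).
Proof. by rewrite pos // mem_cat mem_head orbT. Qed.

Let row_before i : i \in N ++ X -> c (mutation M k) i = c M i.
Proof.
case: split_order => Xk _ _ /Xk[ik _ ki]; apply: row_mutation_fixed => //.
by rewrite bS oppr_le0 (le_trans _ ki).
Qed.

Let row_after i j : i \in Y -> c M k 0 j <= c (mutation M k) i 0 j.
Proof.
case: split_order => _ Yk _ iY; have [ik _ ki] := Yk i iY.
by apply: row_mutation_ge => //; apply: pos; rewrite mem_cat inE iY !orbT.
Qed.

Lemma posvec_mutation i : i \in X ++ Y -> posvec (c (mutation M k) i).
Proof.
rewrite mem_cat => /orP[iX|iY].
  by rewrite row_before ?mem_cat ?iX ?orbT // pos // mem_cat iX.
by apply: posvec_le ck _ => j; apply: row_after.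
Qed.

Lemma negvec_mutation i : i \in N -> negvec (c (mutation M k) i).
Proof. by move=> iN; rewrite row_before ?mem_cat ?iN // neg. Qed.

(** Apart from [r], the vertices receiving arrows from [k] after the mutation lie in [Y], where
    [row_after] gives the bound. *)
Lemma mutation_return :
    (0 < b M r k -> forall j, c M k 0 j <= c (mutation M k) r 0 j) ->
  negvec (c (mutation M k) k) /\
    forall i, 0 < b (mutation M k) k i ->
    forall j, - c (mutation M k) k 0 j <= c (mutation M k) i 0 j.
Proof.
move=> ret; rewrite row_mutation_self negvecN; split=> // i.
rewrite lsub_mutation_l -bS => ik j; rewrite [(- c M k) _ _]mxE opprK.
have [ir|ir] := eqVneq i r; first by rewrite ir in ik *; apply: ret.
have ik' : i != k by apply: contraTneq ik => ->; have := bS k k; lia.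
have := fork_order_mem i fo; rewrite !mem_cat inE ir (negPf ik') /= orbA.
case: split_order => Xk _ _; rewrite -mem_cat => /orP[/Xk[_ _ ki]|iY].
  by move: ik; rewrite bS oppr_gt0 ltNge (le_trans _ ki).
exact: row_after.
Qed.

(** The new row of [r] is [c_r + b_rk c_k] with [b_rk] at least 2. It is at least [c_k]: either
    [c_r] is non-negative, or [c_r >= - c_k] uses up one of the two copies of [c_k]. So [r] joins
    the positive vertices. The alternatives are those of [so_return]; the framed quiver falls under
    the first. *)
Lemma signed_order_mutation_out : 0 < b M r k ->
    posvec (c M r) \/ (forall j, - c M r 0 j <= c M k 0 j) ->
  signed_order (mutation M k) k (X ++ Y ++ [:: r]) N.
Proof.
move=> rk ret; have [_ _ kr] := split_order.
have ler j : c M k 0 j <= c (mutation M k) r 0 j.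
  have rk2 : 2 <= b M r k by have := fo_abundant fo kr; have := bS k r; lia.
  rewrite row_mutation_pos 1?eq_sym // (max_l (ltW rk)).
  have ck0 : 0 <= c M k 0 j by case/andP: ck => _ /forallP.
  have : 2 * c M k 0 j <= b M r k * c M k 0 j by rewrite ler_wpM2r.
  by case: ret => [/andP[_ /forallP/(_ j)]|/(_ j)]; lia.
split.
- by move: (fo); rewrite catA => /fork_order_mutation_out/(_ rk); rewrite -catA.
- move=> i; rewrite catA mem_cat inE => /orP[/posvec_mutation//|/eqP->].
  exact: posvec_le ck ler.
- exact: negvec_mutation.
- by right; apply: mutation_return.
Qed.

(** Here [c_r] does not change, while [r] moves to the very front of the fork order. A positive [r]
    fits there when [N] is empty, as for the framed quiver; in later mutations [so_return] makes [r]
    negative. *)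
Lemma signed_order_mutation_in : 0 < b M k r ->
  [/\ N = [::] -> posvec (c M r) ->
       signed_order (mutation M k) k (r :: X ++ Y) [::]
    & negvec (c M r) -> signed_order (mutation M k) k (X ++ Y) (r :: N)].
Proof.
move=> kr; have [_ _ neq_kr] := split_order.
have rk : b M r k < 0 by rewrite bS oppr_lt0.
have cr : c (mutation M k) r = c M r.
  by apply: row_mutation_fixed; rewrite 1?eq_sym // ltW.
have fo' : fork_order (lsubmx (mutation M k)) k (r :: N ++ X ++ Y).
  by move: (fo); rewrite catA => /fork_order_mutation_in/(_ kr); rewrite -catA.
split=> [N0 r_pos|r_neg]; split=> //=.
- by move: fo'; rewrite N0.
- by move=> i; rewrite inE => /predU1P[->|/posvec_mutation//]; rewrite cr.
- by right; apply: mutation_return; rewrite (lt_gtF rk).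
- exact: posvec_mutation.
- by move=> i; rewrite inE => /predU1P[->|/negvec_mutation//]; rewrite cr.
- by right; apply: mutation_return; rewrite (lt_gtF rk).
Qed.

End PositiveMutation.

(** * Products of reflections under a single mutation *)

Local Open Scope group_scope.

(** Conjugating every factor over [Y] conjugates the whole block, as the inner pairs [R k * R k]
    cancel. The [k] after the block then cancels the trailing [R k] and leaves one in front. *)
Lemma prod_refl_step M k R X Y Z :
    posvec (c M k) -> R k * R k = 1 -> b M k k <= 0 ->
    (forall i, i \in X ++ Z -> b M i k <= 0) ->
    (forall i, i \in Y -> 0 < b M i k)%R ->
  \prod_(i <- X ++ Y ++ k :: Z) refl_step M k R i
    = \prod_(i <- X ++ k :: Y ++ Z) R i.
Proof.
move=> ck Rk2 kk XZk Yk.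
have stepE i : refl_step M k R i =
    if (0 < b M i k)%R then R k * R i * R k else R i.
  by rewrite /refl_step posvec_scale.
have fixed (s : seq 'I_n) : {subset s <= X ++ Z} ->
    \prod_(i <- s) refl_step M k R i = \prod_(i <- s) R i.
  move=> sXZ; rewrite [LHS]big_seq [RHS]big_seq; apply: eq_bigr => i /sXZ/XZk.
  by rewrite stepE leNgt => /negPf->.
have conj : \prod_(i <- Y) refl_step M k R i = R k * (\prod_(i <- Y) R i) * R k.
  elim: Y Yk {XZk fixed} => [|i s IHs] sk; first by rewrite !big_nil mulg1.
  rewrite !big_cons IHs => [|j js]; last by rewrite sk // inE js orbT.
  by rewrite stepE sk ?mem_head // !mulgA -(mulgA _ (R k) (R k)) Rk2 mulg1.
rewrite !(big_cat, big_cons) /= conj !fixed => [|i|i]; last first.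
- by move=> iX; rewrite mem_cat iX.
- by move=> iZ; rewrite mem_cat iZ orbT.
by rewrite stepE ltNge kk /= -!mulgA (mulgA (R k) (R k)) Rk2 mul1g.
Qed.

Lemma prod_rev_involutions R s : (forall i, R i * R i = 1) ->
  \prod_(i <- rev s) R i = (\prod_(i <- s) R i)^-1.
Proof.
move=> R2; elim: s => [|i s IHs]; first by rewrite !big_nil invg1.
rewrite rev_cons -cats1 big_cat big_seq1 big_cons invMg IHs; congr (_ * _).
by apply/eqP; rewrite -mulg_eq1 R2.
Qed.

End ForkState.

(** * Invariance of the ordered product along a mutation sequence *)

Section MutationSequences.
Variable n : nat.
Implicit Types (M : 'M[int]_(n, n + n)) (i j k r : 'I_n).
Implicit Types (P N : seq 'I_n) (R : 'I_n -> ucox n) (w : seq 'I_n).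

Local Notation c M i := (row i (rsubmx M)).
Local Notation b M i j := (lsubmx M i j).

Lemma fork_order_prod_refl_step M r L X k Y Z R :
    fork_order (lsubmx M) r L -> posvec (c M k) -> (R k * R k = 1)%g ->
    (forall i, i \in X ++ Z -> 0 <= b M k i) ->
    (forall i, i \in Y -> 0 < b M i k) ->
  (\prod_(i <- X ++ Y ++ k :: Z) refl_step M k R i
    = \prod_(i <- X ++ k :: Y ++ Z) R i)%g.
Proof.
move=> fo ck Rk2 XZ Yk; apply: prod_refl_step => // [|i /XZ].
  by have := fo_skew fo k k; lia.
by rewrite (fo_skew fo i) oppr_le0.
Qed.

Lemma signed_order_pos_step M r P N k :
    signed_order M r P N -> k != r -> posvec (c M k) ->
  exists P' N', signed_order (mutation M k) k P' N' /\
    forall R, (R k * R k = 1)%g ->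
    (\prod_(i <- P' ++ k :: N') refl_step M k R i
      = \prod_(i <- P ++ r :: N) R i)%g.
Proof.
case=> fo pos neg ret kr ck.
have: k \in N ++ P by rewrite (fork_order_mem _ fo).
rewrite mem_cat => /orP[/neg|kP]; first by rewrite posvec_negvecF.
case/splitPr: kP fo pos => X Y fo pos.
have [Xk Yk _] :
    [/\ forall i, i \in N ++ X -> [/\ i != k, i != r & 2 <= b M k i],
        forall i, i \in Y -> [/\ i != k, i != r & 2 <= b M i k] & k != r].
  by apply: fork_order_split; rewrite -catA.
have NX i : (i \in X) || (i \in N) -> 0 <= b M k i.
  by rewrite orbC -mem_cat => /Xk[_ _]; apply: le_trans.
have Y0 i : i \in Y -> 0 < b M i k by case/Yk=> _ _; apply: lt_le_trans.
have [rk|rk|rk0] := ltgtP 0 (b M r k).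
- exists (X ++ Y ++ [:: r]), N; split.
    apply: (signed_order_mutation_out fo pos neg rk).
    by case: ret => [[]|[_ /(_ k rk)]]; [left|right].
  move=> R Rk2.
  have := @fork_order_prod_refl_step _ _ _ X k (Y ++ [:: r]) N _ fo ck Rk2.
  rewrite -!catA /= => -> // i; first by rewrite mem_cat; apply: NX.
  by rewrite mem_cat inE => /orP[/Y0//|/eqP->].
- have kr0 : 0 < b M k r by rewrite (fo_skew fo) oppr_gt0.
  (* If [c_r] were positive, [so_return] at [k] would give [c_r <= - c_k], making [c_k] negative. *)
  have r_neg : negvec (c M r).
    case: ret => [[r_pos /(_ k kr0) rk_le]|[]//].
    have : posvec (- c M k).
      by apply: posvec_le r_pos _ => j; rewrite [leRHS]mxE.
    by rewrite posvecN posvec_negvecF.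
  have [_ so'] := signed_order_mutation_in fo pos neg kr0.
  exists (X ++ Y), (r :: N); split; first exact: so'.
  move=> R Rk2; rewrite -!catA cat_cons.
  apply: (fork_order_prod_refl_step fo ck Rk2) => [i|]; last exact: Y0.
  rewrite mem_cat inE orbCA => /predU1P[->|/NX //]; exact: ltW.
- by have := fo_abundant fo kr; rewrite (fo_skew fo) -rk0 oppr0.
Qed.

(** The rule sees only the product [b_ik c_k], in which the two signs cancel. *)
Lemma refl_stepN M k R i : refl_step (- M) k R i = refl_step M k R i.
Proof.
rewrite /refl_step; congr (if posvec _ then _ else _).
by apply/rowP => j; rewrite !mxE mulrNN.
Qed.

Lemma refl_step_involution M k R :
  (forall i, R i * R i = 1)%g ->
  forall i, (refl_step M k R i * refl_step M k R i = 1)%g.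
Proof.
move=> R2 i; rewrite /refl_step; case: ifP => // _.
by rewrite -!mulgA (mulgA (R k) (R k)) R2 mul1g (mulgA (R i)) R2 mul1g R2.
Qed.

Lemma signed_order_step M R r P N k :
    signed_order M r P N -> k != r -> (forall i, R i * R i = 1)%g ->
  exists P' N', signed_order (mutation M k) k P' N' /\
    (\prod_(i <- P' ++ k :: N') refl_step M k R i
      = \prod_(i <- P ++ r :: N) R i)%g.
Proof.
move=> soM kr R2; have [foM pos neg _] := soM.
have: k \in N ++ P by rewrite (fork_order_mem _ foM).
rewrite mem_cat => /orP[/neg kN|/pos kP]; last first.
  by have [P' [N' [so' prodE]]] := signed_order_pos_step soM kr kP;
    exists P', N'; split; rewrite ?prodE.
have cN : c (- M) k = - c M k by apply/rowP => j; rewrite !mxE.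
have kN' : posvec (c (- M) k) by rewrite cN posvecN.
have [P' [N' [so' prodE]]] := signed_order_pos_step (signed_orderN soM) kr kN'.
exists (rev N'), (rev P'); split.
  by have := signed_orderN so'; rewrite mutationN opprK.
have rev3 s t (x : 'I_n) : rev s ++ x :: rev t = rev (t ++ x :: s).
  by rewrite rev_cat rev_cons cat_rcons.
(* Both lists for [- M] are reversals, so this is the wanted equality between inverses. *)
move: (prodE R (R2 k)).
rewrite rev3 (eq_bigr _ (fun i _ => refl_stepN M k R i)).
rewrite rev3 (prod_rev_involutions _ R2) => prodN.
rewrite prod_rev_involutions ?prodN ?invgK //; exact: refl_step_involution.
Qed.

Lemma signed_order_steps M R r P N w :
    signed_order M r P N -> (forall i, R i * R i = 1)%g ->
    path [rel i j | i != j] r w ->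
  let MR := foldl (fun MR k => (mutation MR.1 k, refl_step MR.1 k MR.2))
                  (M, R) w in
  exists P' N', signed_order MR.1 (last r w) P' N' /\
    (\prod_(i <- P' ++ last r w :: N') MR.2 i
      = \prod_(i <- P ++ r :: N) R i)%g.
Proof.
elim: w M R r P N => [|k w IHw] M R r P N soM R2 /=; first by exists P, N.
case/andP; rewrite eq_sym => kr kw.
have [P1 [N1 [so1 <-]]] := signed_order_step soM kr R2.
exact: IHw so1 (refl_step_involution _ _ R2) kw.
Qed.

End MutationSequences.

(** * The order of the initial fork and the first mutation *)

Section InitialOrder.
Variable n : nat.
Implicit Types (B : 'M[int]_n) (S : {set 'I_n}) (i j k r : 'I_n).

(** Abundance makes the arrow relation total, and a failure of transitivity would be an oriented
    3-cycle; so sorting yields a linear order. *)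
Lemma acyclic_sort B S : quiver B -> abundant B -> acyclic_on B S ->
  exists2 s, perm_eq s (enum S) & pairwise (fun i j => 2 <= B j i) s.
Proof.
move=> /matrixP qB aB acB; pose e i j := (i == j) || arrow B j i.
have bS i j : B i j = - B j i by have := qB j i; rewrite !mxE.
have tot i j : i != j -> arrow B i j || arrow B j i.
  by move=> /aB; rewrite /arrow /= (bS j i); lia.
exists (sort e (enum S)); first by rewrite perm_sort.
have trS : {in mem S & &, transitive e}.
  move=> j i l jS iS lS; rewrite /e.
  case/predU1P=> [->//|ji] /predU1P[<-|lj]; first by rewrite ji orbT.
  have [//|/tot/orP[il|->//]] := eqVneq i l.
  have lji : {subset [:: l; j; i] <= S}.
    by move=> x; rewrite !inE => /or3P[]/eqP->.
  by have := acB [:: l; j; i] isT lji; rewrite [path.cycle _ _]/= lj ji il.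
have : sorted e (sort e (enum S)).
  apply: sort_sorted => i j; rewrite /e; have [//|/tot] := eqVneq i j.
  by rewrite orbC.
rewrite (sorted_pairwise_in trS); last first.
  by apply/allP => i; rewrite mem_sort mem_enum.
have : uniq (sort e (enum S)) by rewrite sort_uniq enum_uniq.
rewrite uniq_pairwise => neq_s e_s; have := conj neq_s e_s.
move/andP; rewrite -pairwise_relI; apply: sub_pairwise => i j /=.
case/andP=> ij; rewrite /e (negPf ij) /arrow /= => ji.
by have := aB i j ij; rewrite bS; lia.
Qed.

(** By the return condition all arrows between the two sides of [r] go from out- to in-neighbours,
    so the sorted in-neighbours followed by the sorted out-neighbours form one order. *)
Lemma fork_order_exists B r : fork B r -> exists L, fork_order B r L.
Proof.
case=> qB aB _ ret /(acyclic_sort qB aB)[s /perm_mem s_in ps].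
case/(acyclic_sort qB aB) => t /perm_mem t_out pt.
have bS i j : B i j = - B j i by have /matrixP/(_ j i) := qB; rewrite !mxE.
have in_s i : (i \in s) = (0 < B i r) by rewrite s_in mem_enum inE.
have in_t i : (i \in t) = (0 < B r i) by rewrite t_out mem_enum inE.
have in_st i : (i \in s ++ t) = (i != r).
  rewrite mem_cat in_s in_t (bS r i).
  by have [->|/aB] := eqVneq i r; [have := bS r r|]; lia.
have pst : pairwise (fun i j => 2 <= B j i) (s ++ t).
  rewrite pairwise_cat ps pt !andbT; apply/allrelP => i j.
  rewrite s_in t_out !mem_enum => ir rj; have := ret i j ir rj.
  by move: ir; rewrite inE /arrow /=; lia.
exists (s ++ t); split=> // [|i ir|i j ir rj].
- apply: uniq_perm => [||i]; last 1 first.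
  + by rewrite inE in_st mem_enum; case: eqP.
  + rewrite /= in_st eqxx /=; apply: pairwise_uniq pst => i.
    by apply/negbTE; have := bS i i; lia.
  + exact: enum_uniq.
- exact: aB.
- by apply: ret; rewrite inE.
Qed.

(** All framed c-vectors are positive, so [N] is empty and [L] is split at [k]. If [r] has arrows to
    [k], its reflection is conjugated and [r] must stand after [k]; otherwise it is fixed and [r]
    stands before. *)
Lemma fork_first_step B r L k : fork_order B r L -> k != r ->
  exists P, signed_order (mutation (row_mx B 1%:M) k) k P [::] /\
    (\prod_(i <- P ++ [:: k]) refl_step (row_mx B 1%:M) k (@ucox_gen n) i
      = \prod_(i <- if (0 < B r k)%R then rcons L r else r :: L) ucox_gen i)%g.
Proof.
set M := row_mx B 1%:M => fo kr.
have lM : lsubmx M = B by rewrite row_mxKl.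
have cM i : posvec (row i (rsubmx M)).
  rewrite row_mxKr; apply/andP; split; last first.
    by apply/forallP => j; rewrite !mxE; case: (_ == _).
  by apply/eqP => /rowP/(_ i); rewrite !mxE eqxx.
have: k \in L by rewrite (fork_order_mem _ fo).
move=> kL; case/splitPr: kL fo => X Y; rewrite -lM => fo.
have [Xk Yk _] := fork_order_split fo.
have X0 i : i \in X -> 0 <= lsubmx M k i by case/Xk=> _ _; apply: le_trans.
have Y0 i : i \in Y -> 0 < lsubmx M i k.
  by case/Yk=> _ _; apply: lt_le_trans.
have pos i : i \in X ++ k :: Y -> posvec (row i (rsubmx M)) by [].
have neg i : i \in [::] -> negvec (row i (rsubmx M)) by [].
have Rk2 := ucox_gen2 k.
case: ifP => rk.
- exists (X ++ Y ++ [:: r]); split.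
    by apply: (signed_order_mutation_out (N := [::]) fo pos neg rk); left.
  have := @fork_order_prod_refl_step _ _ _ _ X k (Y ++ [:: r]) [::] _ fo
    (cM k) Rk2.
  rewrite -cats1 -!catA /= => -> // i; first by rewrite cats0; apply: X0.
  by rewrite mem_cat inE => /orP[/Y0//|/eqP->].
- have kr0 : 0 < lsubmx M k r.
    have := fo_abundant fo kr; move/negbT: rk; rewrite (fo_skew fo r k); lia.
  have [so' _] := signed_order_mutation_in (N := [::]) fo pos neg kr0.
  exists (r :: X ++ Y); split; first exact: so'.
  have := @fork_order_prod_refl_step _ _ _ _ (r :: X) k Y [::] _ fo (cM k) Rk2.
  rewrite !cats0 /= -!catA => -> // i; rewrite inE => /predU1P[->|/X0//].
  exact: ltW.
Qed.

End InitialOrder.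

(** * From lists to permutations; uniqueness of the sign-adapted ordering *)

Section SignAdapted.
Variable n : nat.
Implicit Types (B : 'M[int]_n) (i j k r : 'I_n) (w L s v : seq 'I_n).

Lemma perm_of_enum s : perm_eq s (enum 'I_n) -> exists p : 'S_n, codom p = s.
Proof.
move=> s_enum; have sz : size s == n.
  by rewrite (perm_size s_enum) size_enum_ord.
have inj : injective (tnth (Tuple sz)).
  by apply/tuple_uniqP; rewrite (perm_uniq s_enum) enum_uniq.
exists (perm inj); rewrite codomE -[RHS](map_tnth_enum (Tuple sz)).
by apply: eq_map => i; rewrite permE.
Qed.

Lemma codom_perm_inj (p q : 'S_n) : codom p = codom q -> p = q.
Proof.
rewrite !codomE => /eq_in_map pq; apply/permP => i.
by apply: pq; rewrite mem_enum.
Qed.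

Lemma prod_codom (G : groupType) (f : 'I_n -> G) (p : 'S_n) :
  (\prod_(i < n) f (p i) = \prod_(i <- codom p) f i)%g.
Proof. by rewrite codomE big_map enumT [index_enum _]unlock. Qed.

Lemma fork_order_total (b : 'M[int]_n) r L i j :
  fork_order b r L -> i != j -> b i j != 0.
Proof.
move=> fo ij; have bS := fo_skew fo; have bA := fo_abundant fo.
have [jr|jr] := eqVneq j r.
  by move: ij; rewrite jr => /bA; apply: contraTneq => ->.
have [ir|ir] := eqVneq i r.
  by rewrite ir bS oppr_eq0; move: (bA j jr); apply: contraTneq => ->.
(* A reflexive and symmetric relation: holding pairwise along [L], it holds for any two members,
   whatever their positions. *)
pose e x y := (x == y) || (b x y != 0).
have : pairwise e L.
  apply: sub_pairwise (fo_pairwise fo) => x y; rewrite /e (bS x) oppr_eq0.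
  by case: eqP => // _; apply: contraTneq => ->.
rewrite pairwise_all2rel; first last.
- by move=> x y; rewrite /e eq_sym (bS x) oppr_eq0.
- by move=> x; rewrite /e eqxx.
move/allrelP/(_ i j); rewrite !(fork_order_mem _ fo) /e (negPf ij); exact.
Qed.

(** Pins down the cut index of a sign-adapted ordering as the number of positive c-vectors. *)
Lemma count_posvec (c : 'I_n -> 'rV[int]_n) (m : nat) v : (m <= size v)%N ->
    all (fun i => posvec (c i)) (take m v) ->
    all (fun i => negvec (c i)) (drop m v) ->
  count (fun i => posvec (c i)) v = m.
Proof.
move=> mv; rewrite all_count => /eqP pos neg.
rewrite -{1}(cat_take_drop m v) count_cat pos size_takel //.
rewrite (eq_in_count (a2 := pred0)) ?count_pred0 ?addn0 // => i.
by move/(allP neg); apply: contraTF => /posvec_negvecF->.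
Qed.

Lemma sign_adapted_unique B w r P N :
    signed_order (framed_mut B w) r P N ->
  exists2 lam, unique (sign_adapted B w r) lam & codom lam = P ++ r :: N.
Proof.
case=> fo pos neg _; have bS := fo_skew fo.
have [|lam lamE] := @perm_of_enum (P ++ r :: N).
  apply: perm_trans (fo_perm fo).
  by apply/seq.permP => a; rewrite /= !count_cat /=; lia.
exists lam => //.
have NP_compl : perm_eq (rev (N ++ P)) (enum [set~ r]).
  apply: uniq_perm; rewrite ?rev_uniq ?enum_uniq ?(fork_order_uniq fo) // => i.
  by rewrite mem_rev (fork_order_mem _ fo) mem_enum !inE.
have NP_sorted : pairwise (arrow (Bmx B w)) (rev (N ++ P)).
  rewrite pairwise_rev; apply: sub_pairwise (fo_pairwise fo) => i j.
  exact: lt_le_trans.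
split.
  exists (rev (N ++ P)), (size P); split=> //.
  - move=> s t sv tv st; rewrite ltnNge; apply/negP; rewrite leq_eqVlt.
    case/predU1P=> [ts|ts]; move: st.
      rewrite /arrow /= ts /Bmx; move: (nth _ _ s) => x.
      by have := bS x x; lia.
    have /(pairwiseP r)/(_ t s tv sv ts) := NP_sorted.
    by rewrite /arrow /= /Bmx bS; lia.
  - rewrite rev_cat -size_rev take_size_cat // drop_size_cat //.
    rewrite size_cat leq_addr !all_rev; split=> //; apply/allP => i.
      exact: pos.
    exact: neg.
  - by rewrite lamE rev_cat -size_rev take_size_cat // drop_size_cat // !revK.
move=> lam' [v [j [v_perm v_sorted [jv v_pos v_neg] lam'E]]].
have v_uniq : uniq v by rewrite (perm_uniq v_perm) enum_uniq.
(* Since any two vertices are joined, the condition on [v] makes it pairwise sorted by the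
   antisymmetric relation [arrow], and such a list is determined by its elements. *)
have vE : v = rev (N ++ P).
  apply: (@pairwise_eq _ (arrow (Bmx B w))) => //.
  - by move=> x y; rewrite /arrow /= /Bmx (bS y); lia.
  - apply/(pairwiseP r) => s t sv tv st.
    have neq : nth r v t != nth r v s by rewrite nth_uniq // gtn_eqF.
    have := fork_order_total fo neq; have := v_sorted t s tv sv.
    rewrite /arrow /= /Bmx bS; lia.
  - by apply: (perm_trans v_perm); rewrite perm_sym.
apply: codom_perm_inj; rewrite lamE lam'E.
have jE : j = size P.
  rewrite -(count_posvec jv v_pos v_neg) vE rev_cat.
  apply: (count_posvec (c := cvec B w));
    rewrite ?size_cat ?size_rev ?leq_addr //.
    rewrite -size_rev take_size_cat // all_rev; exact/allP.
  rewrite -size_rev drop_size_cat // all_rev; exact/allP.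
by rewrite jE vE rev_cat -size_rev take_size_cat // drop_size_cat // !revK.
Qed.

End SignAdapted.

Local Open Scope group_scope.

Theorem theorem1p10 (n : nat) (n_gt0 : (0 < n)%N) (B : 'M[int]_n) (r : 'I_n)
    (forkB : fork B r) :
  (forall w : seq 'I_n, fork_preserving r w ->
     exists lam rho : 'S_n,
       \prod_(i < n) reflection B w (lam i)
         = \prod_(i < n) reflection B [::] (rho i))
  /\
  (exists rho : 'I_n -> 'S_n,
     forall (k : 'I_n) (w : seq 'I_n), fork_preserving r (k :: w) ->
       exists lam : 'S_n,
         unique (sign_adapted B (k :: w) (last k w)) lam /\
         \prod_(i < n) reflection B (k :: w) (lam i)
           = \prod_(i < n) reflection B [::] (rho k i)).
Proof.
have [L fo] := fork_order_exists forkB.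
have [|rho1 rho1E] := @perm_of_enum _ (rcons L r).
  by apply: perm_trans (fo_perm fo); rewrite perm_rcons.
have [rho2 rho2E] := perm_of_enum (fo_perm fo).
have rhoP : exists rho : 'I_n -> 'S_n,
     forall (k : 'I_n) (w : seq 'I_n), fork_preserving r (k :: w) ->
       exists lam : 'S_n,
         unique (sign_adapted B (k :: w) (last k w)) lam /\
         \prod_(i < n) reflection B (k :: w) (lam i)
           = \prod_(i < n) reflection B [::] (rho k i).
  (* The first mutation enters only through the direction of the arrows between [r] and [k], which
     puts [r] last or first. *)
  exists (fun k => if (0 < B r k)%R then rho1 else rho2) => k w /andP[kw kr].
  have [P [so1 prod1]] := fork_first_step fo kr.
  have R2 := refl_step_involution (row_mx B 1%:M) k (@ucox_gen2 n).
  have [P' [N' [so' prod']]] := signed_order_steps so1 R2 kw.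
  (* The fold defining [reflection] carries the mutated matrix along as its first component. *)
  have stateE : (foldl (fun MR k0 => (mutation MR.1 k0, refl_step MR.1 k0 MR.2))
      (row_mx B 1%:M, @ucox_gen n) (k :: w)).1 = framed_mut B (k :: w).
    rewrite /framed_mut; move: (row_mx B 1%:M) (@ucox_gen n).
    by elim: (k :: w) => //= l s IHs M R; apply: IHs.
  have [|lam lam_unique lamE] :=
    @sign_adapted_unique _ B (k :: w) (last k w) P' N'.
    by rewrite -stateE.
  exists lam; split=> //.
  rewrite !prod_codom lamE [LHS]prod' prod1 reflection_nil.
  by congr (bigop _ _ _); case: ifP.
split=> // -[_|k w kw]; first by exists 1, 1.
have [rho rho_w] := rhoP; have [lam [_ prodE]] := rho_w k w kw.
by exists lam, (rho k).
Qed.
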